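(* Let $m\geq 1$. For a descending plane partition $\pi$ of dimension $m$ without special parts, and for $1\leq i\leq m-1$, let $a_i(\pi)$ be the number of parts of $\pi$ (counted with repetition) that are equal to $m-i+1$. Then $\pi\mapsto (a_1(\pi),a_2(\pi),\dots,a_{m-1}(\pi))$ is a bijection from the set of descending plane partitions of dimension $m$ without special parts onto the set of integer words $(a_1,\dots,a_{m-1})$ satisfying $0\leq a_i\leq m-i$ for all $i=1,\dots,m-1$. Consequently, assigning to $\pi$ the unique permutation $\sigma\in\mathfrak{S}_m$ whose inversion word is $(a_1(\pi),\dots,a_{m-1}(\pi))$ gives a bijection from the set of descending plane partitions of dimension $m$ without special parts onto $\mathfrak{S}_m$ (equivalently, onto the set of $m\times m$ permutation matrices). Moreover, under this bijection, the total number of parts of $\pi$ equals the number of inversions of $\sigma$, and if exactly $k-1$ parts of $\pi$ are equal to $m$, then the entry $1$ in the first row of the permutation matrix of $\sigma$ is in position (column) $k$.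
   Context: A descending plane partition is a (possibly empty) array $\pi=(a_{i,j})$ of positive integers with rows $i=1,\dots,k$, where row $i$ is nonempty and consists of the entries $a_{i,i},a_{i,i+1},\dots,a_{i,\mu_i}$ (so $\mu_i\geq i$ and row $i$ has length $\mu_i-i+1$), such that: (1) rows are weakly decreasing: $a_{i,j}\geq a_{i,j+1}$ for $1\leq i\leq k$ and $i\leq j<\mu_i$; (2) columns are strictly decreasing: $a_{i,j}>a_{i+1,j}$ for $1\leq i\leq k-1$ and $i<j\leq\mu_{i+1}$; (3) $a_{i,i}>\mu_i-i+1$ for $1\leq i\leq k$, i.e. the first part of each row is greater than the length of that row; (4) $a_{i,i}\leq\mu_{i-1}-(i-1)+1$ for $2\leq i\leq k$, i.e. the first part of each row is at most the length of the preceding row. (These conditions imply $\mu_1\geq\mu_2\geq\cdots\geq\mu_k\geq k$.) The empty array is a descending plane partition. The parts of $\pi$ are the numbers, with repetitions, appearing in the array. $\pi$ has dimension $m$ if no part is greater than $m$. A part $a_{i,j}$ is special if it does not exceed the number of parts to its left in its row, i.e. if $a_{i,j}\leq j-i$. For a permutation $\sigma\in\mathfrak{S}_m$ of $\{1,\dots,m\}$, an inversion is a pair $(i,j)$ with $i<j$ and $\sigma(i)>\sigma(j)$. The inversion word of $\sigma$ is $(a_1,\dots,a_{m-1})$, where $a_k$ is the number of inversions $(i,j)$ with $\sigma(j)=k$; that is, $a_k$ is the number of elements greater than $k$ standing to the left of $k$ in the word $(\sigma(1),\dots,\sigma(m))$. Every integer word $(b_1,\dots,b_{m-1})$ with $0\leq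 b_k\leq m-k$ is the inversion word of a unique permutation in $\mathfrak{S}_m$. The permutation matrix of $\sigma$ is the $m\times m$ matrix $M$ with $M_{i,j}=1$ if $\sigma(j)=i$ and $M_{i,j}=0$ otherwise. *)

(* Defs.v *)
From HB Require Import structures.
From mathcomp Require Import all_boot all_order all_algebra all_fingroup.
From mathcomp Require Import classical_sets functions.

Set Implicit Arguments.
Unset Strict Implicit.
Unset Printing Implicit Defensive.

Local Open Scope nat_scope.

(* An array is given by the list of its rows, row i being the list of the
   entries a_{i,i}, ..., a_{i,mu_i}. The indices i and j of [mu] and [entry]
   start from 1, and the i-th row starts in column i. *)
Definition mu (p : seq (seq nat)) (i : nat) : nat :=
  (size (nth [::] p i.-1) + i).-1.

Definition entry (p : seq (seq nat)) (i j : nat) : nat :=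
  nth 0 (nth [::] p i.-1) (j - i).

Definition parts (p : seq (seq nat)) : seq nat := flatten p.

Record descending_plane_partition (p : seq (seq nat)) : Prop := {
  dpp_row_nonempty : forall r, r \in p -> r != [::];
  dpp_part_positive : forall x, x \in parts p -> 0 < x;
  dpp_row_decreasing : forall i j, 1 <= i <= size p -> i <= j < mu p i ->
    entry p i j >= entry p i j.+1;
  dpp_column_decreasing : forall i j, 1 <= i <= size p - 1 ->
    i < j <= mu p i.+1 -> entry p i j > entry p i.+1 j;
  dpp_head_gt_length : forall i, 1 <= i <= size p ->
    entry p i i > mu p i - i + 1;
  dpp_head_le_prev_length : forall i, 2 <= i <= size p ->
    entry p i i <= mu p i.-1 - i.-1 + 1
}.

Definition special (p : seq (seq nat)) (i j : nat) : bool :=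
  entry p i j <= j - i.

Definition without_special_parts (p : seq (seq nat)) : Prop :=
  forall i j, 1 <= i <= size p -> i <= j <= mu p i -> ~~ special p i j.

Definition has_dimension (m : nat) (p : seq (seq nat)) : Prop :=
  forall x, x \in parts p -> x <= m.

Definition dpp_without_special (m : nat) : set (seq (seq nat)) :=
  [set p | [/\ descending_plane_partition p, has_dimension m p
             & without_special_parts p]]%classic.

(* Below, i : 'I_n (with n = m or n = m.-1) stands for the index i.+1 of
   {1, ..., n}; likewise for the values of a permutation in 'S_m. *)
Definition multiplicity_word (m : nat) (p : seq (seq nat)) : m.-1.-tuple nat :=
  [tuple count_mem (m - i.+1 + 1) (parts p) | i < m.-1].

Definition bounded_words (m : nat) : set (m.-1.-tuple nat) :=
  [set w | forall i : 'I_m.-1, tnth w i <= m - i.+1]%classic.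
Arguments bounded_words : clear implicits.

Definition inversion (m : nat) (s : 'S_m) (ij : 'I_m * 'I_m) : bool :=
  (ij.1 < ij.2) && (s ij.1 > s ij.2).

Definition inversion_number (m : nat) (s : 'S_m) : nat :=
  #|[pred ij | inversion s ij]|.

Definition inversion_word (m : nat) (s : 'S_m) : m.-1.-tuple nat :=
  [tuple #|[pred ij | inversion s ij && (s ij.2 == k :> nat)]| | k < m.-1].

(* The library's [perm_mx s] is the transpose of this matrix. *)
Definition permutation_matrix (m : nat) (s : 'S_m) : 'M[int]_m :=
  (\matrix_(i, j) (s j == i)%:R)%R.

Definition permutation_matrices (m : nat) : set 'M[int]_m :=
  [set M | is_perm_mx M]%classic.
Arguments permutation_matrices : clear implicits.

(* Main.v *)
Require Import Defs.
From HB Require Import structures.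
From mathcomp Require Import all_boot all_order all_algebra all_fingroup.
From mathcomp Require Import classical_sets functions.
From mathcomp Require Import zify.

Set Implicit Arguments.
Unset Strict Implicit.
Unset Printing Implicit Defensive.

Local Open Scope nat_scope.

(** Read row by row, the parts of a descending plane partition without special
    parts form a weakly decreasing sequence: the last entry of a row is at least
    the length of that row, and the head of the next row is at most that length.
    The array is recovered from the sequence by starting a new row exactly when
    the next part would be special. A decreasing sequence arises in this way if
    and only if each value v occurs at most v - 1 times: a run of v equal parts
    would break the strictness of a column or the condition that the head of a
    row exceeds its length. For permutations, inversion words determine the
    positions of the values 1, 2, ..., m successively, and surjectivity follows
    by counting. *)

(** * Weakly decreasing sequences and multiplicities *)

Lemma geq_trans : transitive geq.
Proof. by move=> y x z /= xy yz; apply: leq_trans yz xy. Qed.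

Lemma sorted_geq_nth s i j : sorted geq s -> i <= j -> nth 0 s j <= nth 0 s i.
Proof.
move=> ss ij; case: (ltnP j (size s)) => [js|/(nth_default 0)->//].
apply: (sorted_leq_nth geq_trans leqnn 0 ss) => //.
by rewrite inE (leq_ltn_trans ij).
Qed.

Lemma sorted_geq_head s x : sorted geq s -> x \in s -> x <= head 0 s.
Proof.
by move=> ss /(nthP 0)[i _ <-]; rewrite -nth0; apply: sorted_geq_nth.
Qed.

Lemma sorted_geq_eq s1 s2 :
  sorted geq s1 -> sorted geq s2 -> perm_eq s1 s2 -> s1 = s2.
Proof.
apply: (sorted_eq geq_trans) => x y.
by rewrite /= andbC => H; apply/eqP; rewrite eqn_leq.
Qed.

Lemma count_mem_size v (s : seq nat) : count_mem v s <= size s.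
Proof. exact: count_size. Qed.

Lemma count_mem_gt_nth v (s : seq nat) t :
  sorted geq s -> v < nth 0 s t -> count_mem v s <= size s - t.+1.
Proof.
move=> ss vt; rewrite -{1}(cat_take_drop t.+1 s) count_cat.
rewrite (count_memPn _) ?add0n; first by rewrite -size_drop count_size.
apply/negP => /(nthP 0)[i]; rewrite size_take_min => it.
rewrite nth_take; last by lia.
by move=> E; have := @sorted_geq_nth s i t ss; rewrite E; lia.
Qed.

Lemma count_mem_lt_nth v (s : seq nat) t :
  sorted geq s -> nth 0 s t < v -> count_mem v s <= t.
Proof.
move=> ss vt; rewrite -(cat_take_drop t s) count_cat.
rewrite [X in _ + X](count_memPn _) ?addn0.
  by rewrite (leq_trans (count_size _ _)) // size_take_min geq_minl.
apply/negP => /(nthP 0)[i]; rewrite nth_drop => _.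
by move=> E; have := @sorted_geq_nth s t (t + i) ss; rewrite E; lia.
Qed.

(** Monotonicity squeezes all entries from position a to position b to the value v. *)
Lemma count_mem_nth_eq v (s : seq nat) a b : sorted geq s -> a <= b < size s ->
  nth 0 s a = v -> nth 0 s b = v -> b - a < count_mem v s.
Proof.
move=> ss abs sa sb.
have: subseq (take (b - a).+1 (drop a s)) s.
  by apply: subseq_trans (take_subseq _ _) (drop_subseq _ _).
move=> /(leq_count_subseq (pred1 v)).
have st: size (take (b - a).+1 (drop a s)) = (b - a).+1.
  by rewrite size_take_min size_drop; lia.
apply: leq_trans; rewrite -{1}st leq_eqVlt; apply/orP; left.
rewrite eq_sym -all_count; apply/(all_nthP 0) => i; rewrite st => it.
rewrite nth_take // nth_drop /=.
have := @sorted_geq_nth s a (a + i) ss; have := @sorted_geq_nth s (a + i) b ss.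
by rewrite sa sb eqn_leq; lia.
Qed.

Lemma exists_sorted_count n (f : nat -> nat) :
  exists2 s, sorted geq s & forall v, count_mem v s = (v < n) * f v.
Proof.
suff [s sP]: exists s, forall v, count_mem v s = (v < n) * f v.
  exists (sort geq s) => [|v].
    by apply: sort_sorted => x y; apply: leq_total.
  by rewrite -sP; apply/seq.permP; rewrite perm_sort.
elim: n => [|n [s sP]]; first by exists [::].
exists (nseq (f n) n ++ s) => v; rewrite count_cat count_nseq /= sP ltnS.
by case: (ltngtP v n) => [||->]; rewrite ?mul0n ?mul1n ?addn0.
Qed.

(** * Plane partitions without special parts, as lists of rows *)

Definition nonspecial_row (r : seq nat) : Prop :=
  [/\ r != [::], sorted geq r, forall t, t < size r -> t < nth 0 r t
    & size r < head 0 r].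

(* With indices from 0, column j of the array is position [j - i] of row i and
   position [j - i - 1] of row i + 1. *)
Definition stacked (r r' : seq nat) : Prop :=
  head 0 r' <= size r /\ forall t, t < size r' -> nth 0 r' t < nth 0 r t.+1.

(** Below the last row, [head [::] p'] is an empty row, and [stacked] then holds trivially. *)
Fixpoint nonspecial_rows (p : seq (seq nat)) : Prop :=
  if p is r :: p' then
    [/\ nonspecial_row r, stacked r (head [::] p') & nonspecial_rows p']
  else True.

Lemma nonspecial_rowsP p : nonspecial_rows p <->
  (forall i, i < size p -> nonspecial_row (nth [::] p i)) /\
  (forall i, i.+1 < size p -> stacked (nth [::] p i) (nth [::] p i.+1)).
Proof.
elim: p => [|r p [IH1 IH2]] /=; first by split.
split=> [[rP rpP /IH1[pP ppP]]|[pP ppP]].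
  split=> [[|i]//|[|i]]; [exact: pP | by rewrite nth0 | exact: ppP].
split; first exact: (pP 0).
  by case: p ppP {IH1 IH2 pP} => [|r' p] ppP //; apply: (ppP 0).
by apply: IH2; split=> i ip; [apply: (pP i.+1) | apply: (ppP i.+1)].
Qed.

Lemma dpp_nonspecial_rows p :
  descending_plane_partition p -> without_special_parts p -> nonspecial_rows p.
Proof.
case=> H1 H2 H3 H4 H5 H6 H; apply/nonspecial_rowsP; split=> i ip.
  have rn := H1 _ (mem_nth [::] ip).
  have sr: 0 < size (nth [::] p i) by rewrite lt0n size_eq0.
  split=> //.
  - apply/(sortedP 0) => t ts.
    (* Row i + 1 starts in column i + 1, so its position t lies in column i + t + 1. *)
    have := H3 i.+1 (i + t).+1; rewrite /entry /mu /=.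
    have -> : (i + t).+1 - i.+1 = t by lia.
    have -> : (i + t).+2 - i.+1 = t.+1 by lia.
    by apply; lia.
  - move=> t ts; have := H i.+1 (i + t).+1; rewrite /special /entry /mu /=.
    have -> : (i + t).+1 - i.+1 = t by lia.
    by rewrite -ltnNge; apply; lia.
  - have := H5 i.+1; rewrite /entry /mu /= subnn nth0.
    by set x := head _ _; lia.
split.
  have := H6 i.+2; rewrite /entry /mu /= subnn nth0.
  have rn := H1 _ (mem_nth [::] (ltnW ip)).
  have sr: 0 < size (nth [::] p i) by rewrite lt0n size_eq0.
  by set x := head _ _; lia.
move=> t ts; have := H4 i.+1 (i + t).+2; rewrite /entry /mu /=.
have -> : (i + t).+2 - i.+1 = t.+1 by lia.
have -> : (i + t).+2 - i.+2 = t by lia.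
by apply; lia.
Qed.

Lemma nonspecial_rows_dpp p : nonspecial_rows p ->
  descending_plane_partition p /\ without_special_parts p.
Proof.
move=> /nonspecial_rowsP[pP ppP].
have size_gt0 i : i < size p -> 0 < size (nth [::] p i).
  by move=> /pP[]; rewrite lt0n size_eq0.
split; first split.
- by move=> r /(nthP [::])[i ip <-]; case: (pP i ip).
- move=> x /flattenP[r /(nthP [::])[i ip <-]] /(nthP 0)[t ts <-].
  (* A part that is not special exceeds its position in the row, hence is positive. *)
  by case: (pP i ip) => _ _ /(_ t ts) + _; apply: leq_ltn_trans.
- move=> [|i] j ip; rewrite /mu /entry /= => jm; first by lia.
  case: (pP i ltac:(lia)) => _ ss _ _.
  by apply: (sorted_geq_nth ss); lia.
- move=> [|i] j ip; rewrite /mu /entry /= => jm; first by lia.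
  have [_] := ppP i ltac:(lia).
  move=> /(_ (j - i.+2)); have -> : (j - i.+2).+1 = j - i.+1 by lia.
  by apply; lia.
- move=> [|i] ip; rewrite /mu /entry /=; first by lia.
  have ip' : i < size p by lia.
  case: (pP i ip') => _ _ _; have := size_gt0 _ ip'.
  by rewrite subnn nth0; set x := head _ _; lia.
- move=> [|[|i]] ip; rewrite /mu /entry /=; try lia.
  have [+ _] := ppP i ltac:(lia); have := size_gt0 i ltac:(lia).
  by rewrite subnn nth0; set x := head _ _; lia.
move=> [|i] j ip; rewrite /mu /special /entry /= => jm; first by lia.
have := size_gt0 i ltac:(lia) => s0.
case: (pP i ltac:(lia)) => _ _ /(_ (j - i.+1)) + _.
by rewrite -ltnNge; apply; lia.
Qed.

(** * Reading an array row by row *)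

Lemma nonspecial_rows_nil p :
  nonspecial_rows p -> flatten p = [::] -> p = [::].
Proof. by case: p => //= -[|x r] p [[]]. Qed.

Lemma head_flatten p :
  nonspecial_rows p -> head 0 (flatten p) = head 0 (head [::] p).
Proof. by case: p => //= -[|x r] p [[]]. Qed.

Lemma nonspecial_rows_sorted p : nonspecial_rows p -> sorted geq (flatten p).
Proof.
elim: p => //= r p IH [[rn rs rP rh] [rp _] pP].
have {IH}ps := IH pP; apply/(sortedP 0) => t; rewrite size_cat => ts /=.
have sr: 0 < size r by rewrite lt0n size_eq0.
rewrite !nth_cat; case: ltnP => tr1; case: ltnP => tr2; try lia.
- exact: sorted_geq_nth.
(* At the boundary of two rows, the last entry of [r] exceeds [size r - 1], and the next head is at
   most [size r]. *)
- have -> : t.+1 - size r = 0 by lia.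
  rewrite nth0 head_flatten //; apply: leq_trans rp _.
  by have := rP t tr2; lia.
- by apply: sorted_geq_nth => //; lia.
Qed.

(* The first row ends at the first position t whose entry is at most t: there
   it would be special, and the head of the next row is at most the length of
   the first. *)
Lemma flatten_inj p q : nonspecial_rows p -> nonspecial_rows q ->
  flatten p = flatten q -> p = q.
Proof.
have size_le r p' u q' : nonspecial_rows (r :: p') -> nonspecial_rows (u :: q') ->
    r ++ flatten p' = u ++ flatten q' -> size u <= size r.
  move=> [_ [rp _] pP] [[_ _ uP _] _ _] E; rewrite leqNgt; apply/negP => ru.
  have: nth 0 (u ++ flatten q') (size r) = nth 0 u (size r).
    by rewrite nth_cat ru.
  rewrite -E nth_cat ltnn subnn nth0 head_flatten // => E'.
  by have := uP _ ru; rewrite -E' ltnNge rp.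
elim: p q => [|r p IH] [|u q] pP qP E //.
- by rewrite (nonspecial_rows_nil qP).
- by rewrite (nonspecial_rows_nil pP).
move: (E) => /= E'; have sru: size r = size u.
  by apply/eqP; rewrite eqn_leq (size_le _ _ _ _ pP qP) // (size_le _ _ _ _ qP pP).
move/eqP: E'; rewrite eqseq_cat // => /andP[/eqP-> /eqP E'].
by congr cons; apply: IH E'; [case: pP | case: qP].
Qed.

(** * The multiplicity bound *)

(** If v is the head, it exceeds the length of the row. If v is below the head, at most [size r - 1]
    entries equal v; and when v < [size r], even the last entry exceeds v, so v does not occur. *)
Lemma nonspecial_row_count r v : 0 < v -> nonspecial_row r -> count_mem v r < v.
Proof.
move=> v0 [rn rs rP rh]; have sr: 0 < size r by rewrite lt0n size_eq0.
move: rh; rewrite -nth0 => rh; have := count_mem_size v r.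
case: (ltngtP (nth 0 r 0) v) => [h|h|h].
- by have := count_mem_lt_nth rs h; lia.
- have := count_mem_gt_nth rs h.
  have := @count_mem_gt_nth v r (size r).-1 rs.
  by have := rP (size r).-1; lia.
- by lia.
Qed.

(* A value v occurring both in the rows r and r' is the length of r and the
   head of r', hence occurs in no later row; if it occurs c times in r', strict
   columns keep it out of the first c + 1 columns of r. *)
Lemma nonspecial_rows_count p v :
  0 < v -> nonspecial_rows p -> count_mem v (flatten p) < v.
Proof.
move=> v0; elim: p => [|r p IH] //= [rP [rp rpP] pP]; rewrite count_cat.
have [vp|/count_memPn->] := boolP (v \in flatten p); last first.
  by rewrite addn0 nonspecial_row_count.
have [vr|/count_memPn->] := boolP (v \in r); last exact: IH.
case: (rP) => rn rs rS _; have sr: 0 < size r by rewrite lt0n size_eq0.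
have vle := sorted_geq_head (nonspecial_rows_sorted pP) vp.
rewrite head_flatten // in vle.
have vge : size r <= v.
  have [t tr <-] : exists2 t, t < size r & nth 0 r t = v by apply/nthP.
  have := @sorted_geq_nth r t (size r).-1 rs; have := rS (size r).-1.
  by lia.
have {vge vle} [sv hv] : size r = v /\ head 0 (head [::] p) = v by lia.
case: p hv pP rpP {IH vp rp} => [|r' p] /= hv; first by lia.
move=> [[rn' rs' _ rh'] [rp' _] pP] rpP.
rewrite count_cat [X in _ + (_ + X)](count_memPn _) ?addn0; last first.
  apply/negP => /(sorted_geq_head (nonspecial_rows_sorted pP)).
  by rewrite head_flatten //; lia.
have := count_mem_size v r'.
case E: (count_mem v r') => [|c] cr'; first by rewrite addn0 nonspecial_row_count.
have vc : v <= nth 0 r' c.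
  by rewrite leqNgt; apply/negP => /(count_mem_lt_nth rs'); rewrite E ltnn.
(* Position c + 1 of [r] exceeds v, so [r] contains v at most v - c - 2 times; the c + 1 occurrences
   in [r'] bring the total to at most v - 1. *)
have /= := count_mem_gt_nth rs (leq_ltn_trans vc (rpP _ cr')).
by lia.
Qed.

(** * Rebuilding an array from its sequence of parts *)

Lemma nonspecial_rows_exist s : sorted geq s ->
  (forall v, v \in s -> count_mem v s < v) ->
  exists2 p, nonspecial_rows p & flatten p = s.
Proof.
have [n] := ubnP (size s); elim: n s => // n IH s sn ss sc.
case: (posnP (size s)) => [/size0nil->|s0]; first by exists [::].
(* The first row will be [take l s], cut at the first entry that would be special. The default value
   0 makes [size s] a candidate for [l]. *)
have [|l ls lmin] := @ex_minnP (fun t => nth 0 s t <= t).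
  by exists (size s); rewrite nth_default.
have l0 : 0 < l.
  rewrite lt0n; apply/eqP => l0; rewrite l0 in ls.
  by have /= := sc _ (mem_nth 0 s0); lia.
have lsz : l <= size s by apply: lmin; rewrite nth_default.
have sl : size (take l s) = l by rewrite size_take_min; lia.
have ngt t : t < l -> t < nth 0 s t.
  by move=> tl; rewrite ltnNge; apply/negP => /lmin; lia.
(* Such a run would contain l copies of the value l. *)
have no_run a : a + l.-1 < size s -> nth 0 s a = l -> nth 0 s (a + l.-1) = l -> False.
  move=> al sa sb; have := @count_mem_nth_eq l s a (a + l.-1) ss.
  have /sc /= : l \in s by rewrite -sa mem_nth //=; lia.
  by lia.
have [|||p pP pE] := IH (drop l s).
- by rewrite size_drop; lia.
- exact: drop_sorted.
- move=> v /mem_drop/sc; apply: leq_trans; rewrite ltnS.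
  by rewrite -{2}(cat_take_drop l s) count_cat leq_addl.
exists (take l s :: p); last by rewrite /= pE cat_take_drop.
have hp : head 0 (head [::] p) = nth 0 s l.
  by rewrite -head_flatten // pE -nth0 nth_drop addn0.
have sll := ngt l.-1 ltac:(lia).
split=> //; split=> //.
- by rewrite -size_eq0 sl; lia.
- exact: take_sorted.
- by move=> t; rewrite sl => tl; rewrite nth_take // ngt.
(* The entry at l - 1 is at least l, so a head of at most l would start a run of l entries equal to
   l. *)
- rewrite sl -nth0 nth_take //.
  have := @sorted_geq_nth s 0 l.-1 ss; have := no_run 0; rewrite add0n.
  by lia.
- by rewrite hp sl.
case: p hp pP pE => //= r p hr [[_ rs _ rh] _ _] pE t tr.
have tl : t.+1 < l by lia.
have rt : nth 0 r t = nth 0 s (l + t).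
  by rewrite -nth_drop -pE nth_cat tr.
have lts : l + t < size s.
  by have := congr1 size pE; rewrite size_cat size_drop; lia.
rewrite nth_take // rt.
(* The entries at t + 1 and l - 1 are at least l, those at l and l + t at most l. Equality at t + 1
   and l + t would give a run of length l. *)
have := @sorted_geq_nth s t.+1 l.-1 ss; have := @sorted_geq_nth s l (l + t) ss.
have := no_run t.+1; have -> : t.+1 + l.-1 = l + t by lia.
by lia.
Qed.

(** * Inversion codes of permutations *)

(** This extends the entries of [inversion_word] to k = m - 1, where the code is 0, so that sums and
    products run over all of ['I_m]. *)
Definition inversion_code (m : nat) (s : 'S_m) (k : nat) : nat :=
  #|[pred ij | inversion s ij && (s ij.2 == k :> nat)]|.

(** An inversion whose smaller value is k is determined by its left position. The weak [k <= s p]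
    adds nothing, since p differs from the position of k. *)
Lemma inversion_codeE m (s : 'S_m) (k : 'I_m) : inversion_code s k =
  #|[set p : 'I_m | (p < s^-1%g k) && (k <= s p)]|.
Proof.
have inj_pair : injective (fun p : 'I_m => (p, s^-1%g k)) by move=> p q [].
rewrite -(card_imset _ inj_pair); apply: eq_card => -[i j]; rewrite !inE /=.
apply/idP/imsetP => [/andP[/andP[ij sij] /eqP/val_inj sj]|[p + [-> ->]]].
  exists i; last by rewrite -sj permK.
  by rewrite inE -sj permK ij (ltnW sij).
rewrite inE permKV /inversion /= permKV => /andP[pk].
rewrite pk eqxx andbT leq_eqVlt => /orP[/eqP/val_inj kE|//].
by rewrite kE permK ltnn in pk.
Qed.

Lemma card_ord_lt m n : n <= m -> #|[pred v : 'I_m | v < n]| = n.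
Proof.
move=> nm; rewrite -sum1_card -(big_ord_widen _ (fun=> 1) nm).
by rewrite sum1_card card_ord.
Qed.

(** The counted positions carry distinct values greater than k. *)
Lemma inversion_code_le m (s : 'S_m) (k : 'I_m) :
  inversion_code s k <= m - k.+1.
Proof.
rewrite inversion_codeE -(card_imset _ (@perm_inj _ s)).
rewrite -[X in X - _]card_ord -(card_ord_lt (ltn_ord k)) -(cardC [pred v : 'I_m | v < k.+1]).
rewrite addKn; apply/subset_leq_card/fintype.subsetP => _ /imsetP[p + ->].
rewrite !inE -leqNgt => /andP[pk]; rewrite leq_eqVlt => /orP[/eqP/val_inj kE|//].
by rewrite kE permK ltnn in pk.
Qed.

(* The code at k is the rank of the position of k among the positions not
   occupied by smaller values. *)
Lemma inversion_code_inj m (s t : 'S_m) :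
  (forall k : 'I_m, inversion_code s k = inversion_code t k) -> s = t.
Proof.
move=> E; apply: invg_inj; apply/permP => k.
have [n] := ubnP k; elim: n k => // n IH k kn.
(* By induction, the values below k occupy the same positions in [s] and [t]. *)
have lt_iff p : (k <= s p) = (k <= t p).
  rewrite [LHS]leqNgt [RHS]leqNgt; congr negb; apply/idP/idP => lt.
    by have := IH (s p) (leq_trans lt kn); rewrite permK => ->; rewrite permKV.
  by have := IH (t p) (leq_trans lt kn); rewrite permK => <-; rewrite permKV.
have ltn_card (u : 'S_m) (a b : 'I_m) : k <= u a -> a < b ->
    #|[set p : 'I_m | (p < a) && (k <= u p)]| <
    #|[set p : 'I_m | (p < b) && (k <= u p)]|.
  move=> ka ab; apply/proper_card/properP; split.
    apply/fintype.subsetP => p; rewrite !inE => /andP[pa ->].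
    by rewrite (ltn_trans pa ab).
  by exists a; rewrite !inE ?ltnn // ab ka.
have Ek := E k; rewrite !inversion_codeE in Ek.
have Es : [set p : 'I_m | (p < s^-1%g k) && (k <= s p)] =
    [set p : 'I_m | (p < s^-1%g k) && (k <= t p)].
  by apply/setP => p; rewrite !inE lt_iff.
rewrite Es in Ek.
apply/val_inj; case: (ltngtP (s^-1%g k) (t^-1%g k)) => // lt.
  have ks : k <= t (s^-1%g k) by rewrite -lt_iff permKV.
  by have := ltn_card t _ _ ks lt; rewrite Ek ltnn.
have kt : k <= t (t^-1%g k) by rewrite permKV.
by have := ltn_card t _ _ kt lt; rewrite Ek ltnn.
Qed.

Lemma prod_sub_fact m : \prod_(k < m) (m - k) = m`!.
Proof.
elim: m => [|m IH]; first by rewrite big_ord0.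
by rewrite big_ord_recl subn0 factS; congr (_ * _); rewrite -IH.
Qed.

(** The code is an injection of the m! permutations into the functions with m - k possible values at
    each k, and there are m! of these too. *)
Lemma inversion_code_surj m (w : nat -> nat) :
  (forall k : 'I_m, w k <= m - k.+1) ->
  exists s : 'S_m, forall k : 'I_m, inversion_code s k = w k.
Proof.
pose bounded := family (fun k : 'I_m => [pred v : 'I_m | v < m - k]).
have lt_m (k : 'I_m) n : n <= m - k.+1 -> n < m by have := ltn_ord k; lia.
pose code (s : 'S_m) : {ffun 'I_m -> 'I_m} :=
  [ffun k => Ordinal (lt_m k _ (inversion_code_le s k))].
have code_inj : injective code.
  move=> s t /ffunP E; apply: inversion_code_inj => k.
  by have := congr1 val (E k); rewrite !ffunE.
have card_eq : #|code @: [set: 'S_m]| = #|bounded|.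
  rewrite card_imset // cardsT card_Sn card_family foldrE big_map big_enum /=.
  rewrite -prod_sub_fact; apply: eq_bigr => k _.
  by rewrite card_ord_lt // leq_subr.
have code_bounded : code @: [set: 'S_m] \subset bounded.
  apply/fintype.subsetP => _ /imsetP[s _ ->]; apply/familyP => k; rewrite ffunE inE /=.
  by have := inversion_code_le s k; have := ltn_ord k; lia.
move=> wP; pose f : {ffun 'I_m -> 'I_m} := [ffun k => Ordinal (lt_m k _ (wP k))].
have : f \in bounded.
  apply/familyP => k; rewrite ffunE inE /=.
  by have := wP k; have := ltn_ord k; lia.
rewrite -(subset_cardP card_eq code_bounded) => /imsetP[s _ /ffunP E].
by exists s => k; have := congr1 val (E k); rewrite !ffunE.
Qed.

(** Inversions are grouped by their smaller value. *)
Lemma inversion_number_code m (s : 'S_m) :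
  inversion_number s = \sum_(k < m) inversion_code s k.
Proof.
rewrite /inversion_number -sum1_card (partition_big (fun ij => s ij.2) predT) //=.
by apply: eq_bigr => k _; rewrite /inversion_code -sum1_card.
Qed.

(** Every position to the left of the smallest value gives an inversion. *)
Lemma inversion_code0 m (hm : 0 < m) (s : 'S_m) :
  inversion_code s 0 = s^-1%g (Ordinal hm).
Proof.
rewrite -[0]/(nat_of_ord (Ordinal hm)) inversion_codeE.
rewrite -[RHS](@card_ord_lt m) ?(ltnW (ltn_ord _)) //.
by apply: eq_card => p; rewrite !inE andbT.
Qed.

Lemma inversion_word_inj m : injective (@inversion_word m).
Proof.
move=> s t E; apply: inversion_code_inj => k.
have [km|km] := ltnP k m.-1.
  by have := congr1 (fun w => tnth w (Ordinal km)) E; rewrite !tnth_mktuple.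
(* At k = m - 1, outside the word, both codes are bounded by 0. *)
have := inversion_code_le s k; have := inversion_code_le t k.
by have := ltn_ord k; lia.
Qed.

Lemma inversion_word_surj m (w : m.-1.-tuple nat) :
  bounded_words m w -> exists s : 'S_m, inversion_word s = w.
Proof.
move=> wP; have [k|s sP] := @inversion_code_surj m (nth 0 w).
  have [km|km] := ltnP k m.-1; last by rewrite nth_default ?size_tuple.
  by have := wP (Ordinal km); rewrite (tnth_nth 0).
exists s; apply/eq_from_tnth => k; rewrite tnth_mktuple (tnth_nth 0).
have km : k < m by have := ltn_ord k; lia.
exact: (sP (Ordinal km)).
Qed.

(** * Multiplicity words and the bijections *)

Lemma permutation_matrixE m (s : 'S_m) : permutation_matrix s = perm_mx s^-1%g.
Proof.
apply/matrixP => i j; rewrite !mxE; congr (_%:R)%R.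
by rewrite -(inj_eq (@perm_inj _ s^-1%g)) permK eq_sym.
Qed.

Lemma dpp_without_specialP m p :
  dpp_without_special m p <-> nonspecial_rows p /\ has_dimension m p.
Proof.
split=> [[p1 p2 p3]|[/nonspecial_rows_dpp[p1 p3] p2]]; last by split.
by split=> //; apply: dpp_nonspecial_rows.
Qed.

Lemma dpp_part_bounds m p x :
  dpp_without_special m p -> x \in parts p -> 0 < x <= m.
Proof. by case=> -[_ pos _ _ _ _] dim _ xp; rewrite pos // dim. Qed.

Lemma dpp_count_lt m p v :
  dpp_without_special m p -> 0 < v -> count_mem v (parts p) < v.
Proof. by move=> /dpp_without_specialP[pP _] v0; apply: nonspecial_rows_count. Qed.

(** The value 1 is excluded by the multiplicity bound; hence m - 1 multiplicities describe all
    parts. *)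
Lemma dpp_count_eq0 m p v :
  dpp_without_special m p -> ~~ (1 < v <= m) -> count_mem v (parts p) = 0.
Proof.
move=> pP vm; have [v1|v1] := eqVneq v 1.
  by apply/eqP; rewrite v1 -leqn0 -ltnS; apply: dpp_count_lt pP _.
by apply/count_memPn/negP => /(dpp_part_bounds pP); lia.
Qed.

Lemma multiplicity_word_count m p q :
  dpp_without_special m p -> dpp_without_special m q ->
  multiplicity_word m p = multiplicity_word m q ->
  perm_eq (parts p) (parts q).
Proof.
move=> pP qP E; apply/allP => v _ /=; apply/eqP.
have [vm|vm] := boolP (1 < v <= m); last by rewrite !(dpp_count_eq0 _ vm).
have im : m - v < m.-1 by lia.
have := congr1 (fun w => tnth w (Ordinal im)) E; rewrite !tnth_mktuple /=.
by have -> : m - (m - v).+1 + 1 = v by lia.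
Qed.

Lemma multiplicity_word_inj m :
  set_inj (dpp_without_special m) (multiplicity_word m).
Proof.
move=> p q; rewrite !inE => pP qP /(multiplicity_word_count pP qP) E.
move: pP qP => /dpp_without_specialP[pP _] /dpp_without_specialP[qP _].
by apply: flatten_inj => //; apply: sorted_geq_eq => //; apply: nonspecial_rows_sorted.
Qed.

Lemma multiplicity_word_bounded m p :
  dpp_without_special m p -> bounded_words m (multiplicity_word m p).
Proof.
move=> pP i; rewrite tnth_mktuple -ltnS -[(m - i.+1).+1]addn1.
by apply: dpp_count_lt pP _; rewrite addn1.
Qed.

Lemma multiplicity_word_surj m w : bounded_words m w ->
  exists2 p, dpp_without_special m p & multiplicity_word m p = w.
Proof.
(* With indices from 0, the multiplicity of v is at index m - v of the word. *)
move=> wP; pose f v := if v < 2 then 0 else nth 0 w (m - v).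
have [s ss sE] := exists_sorted_count m.+1 f.
have sP v : v \in s -> count_mem v s < v /\ v <= m.
  rewrite -has_pred1 has_count sE /f; case: (ltnP v m.+1) => // vm.
  case: (ltnP v 2) => // v2 _; split=> //; rewrite /= mul1n.
  have im : m - v < m.-1 by lia.
  by have := wP (Ordinal im); rewrite (tnth_nth 0) /=; lia.
have [v /sP[]//|p pP pE] := nonspecial_rows_exist ss.
exists p; first by apply/dpp_without_specialP; split=> // x; rewrite /parts pE => /sP[].
apply/eq_from_tnth => i; rewrite tnth_mktuple (tnth_nth 0) /parts pE sE /f.
have im := ltn_ord i; have -> : m - (m - i.+1 + 1) = i by lia.
have -> : m - i.+1 + 1 < m.+1 by lia.
have -> : (m - i.+1 + 1 < 2) = false by lia.
by rewrite /= mul1n.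
Qed.

Lemma multiplicity_word_bij m :
  set_bij (dpp_without_special m) (bounded_words m) (multiplicity_word m).
Proof.
split; first exact: multiplicity_word_bounded.
  exact: multiplicity_word_inj.
by move=> w /multiplicity_word_surj[p pP pE]; exists p.
Qed.

Lemma size_sum_count m (s : seq nat) : {in s, forall x, 0 < x <= m} ->
  size s = \sum_(k < m) count_mem (m - k) s.
Proof.
elim: s => [|x s IH] sP; first by rewrite big1.
rewrite /= big_split /= -IH; last by move=> y ys; apply: sP; rewrite inE ys orbT.
have /andP[x0 xm] := sP x (mem_head _ _).
have mx : m - x < m by lia.
rewrite (bigD1 (Ordinal mx)) //= subKn // eqxx big1 // => k /eqP kx.
case: eqP => // xk; case: kx; apply/val_inj => /=.
by have := ltn_ord k; lia.
Qed.

Lemma inversion_code_count m p (s : 'S_m) : dpp_without_special m p ->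
  inversion_word s = multiplicity_word m p ->
  forall k : 'I_m, inversion_code s k = count_mem (m - k) (parts p).
Proof.
move=> pP E k; have mk := ltn_ord k; have [km|km] := ltnP k m.-1.
  have := congr1 (fun w => tnth w (Ordinal km)) E; rewrite !tnth_mktuple /=.
  by have -> : m - k.+1 + 1 = m - k by lia.
rewrite (dpp_count_eq0 pP); last by lia.
by have := inversion_code_le s k; lia.
Qed.

Theorem mainTheorem1 (m : nat) (hm : 1 <= m) :
  set_bij (dpp_without_special m) (bounded_words m) (multiplicity_word m) /\
  exists phi : seq (seq nat) -> 'S_m,
    [/\ forall p, dpp_without_special m p -> forall s : 'S_m,
          inversion_word s = multiplicity_word m p <-> s = phi p,
        set_bij (dpp_without_special m) [set: 'S_m]%classic phi,
        set_bij (dpp_without_special m) (permutation_matrices m)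
          (fun p => permutation_matrix (phi p)),
        forall p, dpp_without_special m p ->
          size (parts p) = inversion_number (phi p)
      & forall p (k : nat), dpp_without_special m p -> 1 <= k ->
          count_mem m (parts p) = k - 1 ->
          exists j : 'I_m, j.+1 = k /\
            forall j' : 'I_m,
              permutation_matrix (phi p) (Ordinal hm) j' = ((j' == j)%:R)%R].
Proof.
split; first exact: multiplicity_word_bij.
(* The identity is a default value; for the arrays considered, surjectivity of inversion words
   provides a choice. *)
pose phi p : 'S_m :=
  odflt 1%g [pick s | inversion_word s == multiplicity_word m p].
have phiE p : dpp_without_special m p ->
    inversion_word (phi p) = multiplicity_word m p.
  move=> /multiplicity_word_bounded/inversion_word_surj[s sE].
  by rewrite /phi; case: pickP => [t /eqP //|/(_ s)]; rewrite sE eqxx.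
have phi_bij : set_bij (dpp_without_special m) [set: 'S_m]%classic phi.
  split=> // [p q pP qP E|s _].
    move: (pP) (qP); rewrite !inE => pP' qP'.
    by apply: (@multiplicity_word_inj m) => //; rewrite -!phiE // E.
  have [k|p pP pE] := @multiplicity_word_surj m (inversion_word s).
    rewrite tnth_mktuple; have mk : k < m by have := ltn_ord k; lia.
    exact: (inversion_code_le s (Ordinal mk)).
  by exists p => //; apply: inversion_word_inj; rewrite phiE.
exists phi; split=> //.
- move=> p pP s; split=> [E|->]; last exact: phiE.
  by apply: inversion_word_inj; rewrite E phiE.
- have [_ phi_inj phi_surj] := phi_bij; split.
  + by move=> p _; rewrite /permutation_matrices /= permutation_matrixE perm_mx_is_perm.
  + move=> p q pP qP; rewrite !permutation_matrixE => /matrixP E.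
    apply: phi_inj => //; apply: invg_inj; apply/permP => i.
    (* The matrices are compared at the entry 1 of row i of the second one. *)
    have := E i ((phi q)^-1%g i); rewrite !mxE eqxx.
    by case: eqP.
  + move=> M /is_perm_mxP[s ->]; have [p pP pE] := phi_surj s^-1%g I.
    by exists p => //; rewrite permutation_matrixE pE invgK.
- move=> p pP; rewrite inversion_number_code (size_sum_count (m := m)); last first.
    by move=> x; apply: dpp_part_bounds.
  by apply: eq_bigr => k _; rewrite (inversion_code_count pP (phiE _ pP)).
(* The column is the position of the smallest value; counted from 0, it is the code at 0, that is,
   the multiplicity k - 1 of m. *)
move=> p k pP k1 pk; exists ((phi p)^-1%g (Ordinal hm)); split.
  rewrite -inversion_code0 -[0]/(nat_of_ord (Ordinal hm)).
  by rewrite (inversion_code_count pP (phiE _ pP)) subn0 pk subn1 prednK.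
by move=> j; rewrite mxE -(inj_eq (@perm_inj _ (phi p)^-1%g)) permK.
Qed.
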